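(* Let $(A,d)$ be a difference algebra and $((M_1\xrightarrow{\delta}M_0,\nu),\Delta_0,\Delta_1,\theta)$ be a $2$-term bimodule up to homotopy over it. Then $$(\mathfrak{a},\mathfrak{d})=\big((M_1\xrightarrow{\widetilde{\delta}}A\oplus M_0,\odot,\mu),\ (d_0=d\oplus\Delta_0,\ d_1=\Delta_1,\ d_2)\big)$$ is a $2$-term difference $A_\infty$-algebra, where $\widetilde{\delta}(\xi)=(0,\delta(\xi))$, $$(a,u)\odot(b,v):=(ab,\,av+ub),\quad(a,u)\odot\xi:=a\xi,\quad\xi\odot(a,u):=\xi a,\quad\xi\odot\eta:=0,$$ $$\mu((a,u),(b,v),(c,w)):=\nu(a,b,w)+\nu(a,v,c)+\nu(u,b,c),$$ and the bilinear map $d_2:(A\oplus M_0)\times(A\oplus M_0)\to M_1$ is given by $$d_2((a,u),(b,v)):=\theta(a,v)+\theta(u,b),$$ for $(a,u),(b,v),(c,w)\in A\oplus M_0$ and $\xi,\eta\in M_1$.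
   Context: All vector spaces are over a field $\mathbf{k}$ of characteristic $0$. A difference algebra $(A,d)$ is an associative algebra $A$ (not assumed unital) with a linear map $d:A\to A$ satisfying $d(ab)=d(a)b+ad(b)+d(a)d(b)$. **2-term difference $A_\infty$-algebras.** A $2$-term $A_\infty$-algebra $\mathfrak{a}=(A_1\xrightarrow{\delta}A_0,\odot,\mu)$ consists of a linear map $\delta:A_1\to A_0$ of vector spaces, bilinear maps $\odot:A_i\times A_j\to A_{i+j}$ ($0\le i+j\le1$; the product of two elements of $A_1$ is understood to be zero) and a trilinear map $\mu:A_0\times A_0\times A_0\to A_1$ such that for all $x,y,z,t\in A_0$, $h,k\in A_1$: (A1) $\delta(x\odot h)=x\odot\delta(h)$; (A2) $\delta(h\odot x)=\delta(h)\odot x$; (A3) $\delta(h)\odot k=h\odot\delta(k)$; (A4) $x\odot(y\odot z)-(x\odot y)\odot z=\delta(\mu(x,y,z))$; (A5) $x\odot(y\odot h)-(x\odot y)\odot h=\mu(x,y,\delta(h))$; (A6) $x\odot(h\odot y)-(x\odot h)\odot y=\mu(x,\delta(h),y)$; (A7) $h\odot(x\odot y)-(h\odot x)\odot y=\mu(\delta(h),x,y)$; (A8) $x\odot\mu(y,z,t)-\mu(x\odot y,z,t)+\mu(x,y\odot z,t)-\mu(x,y,z\odot t)+\mu(x,y,z)\odot t=0$. A difference operator on $\mathfrak{a}$ is a triple $\mathfrak{d}=(d_0,d_1,d_2)$ of linear maps $d_0:A_0\to A_0$, $d_1:A_1\to A_1$ with $d_0\circ\delta=\delta\circ d_1$ and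 a bilinear map $d_2:A_0\times A_0\to A_1$ such that for all $x,y,z\in A_0$, $h\in A_1$: (D1) $d_0(x)\odot y+x\odot d_0(y)+d_0(x)\odot d_0(y)-d_0(x\odot y)=\delta(d_2(x,y))$; (D2) $d_0(x)\odot h+x\odot d_1(h)+d_0(x)\odot d_1(h)-d_1(x\odot h)=d_2(x,\delta(h))$; (D3) $d_1(h)\odot x+h\odot d_0(x)+d_1(h)\odot d_0(x)-d_1(h\odot x)=d_2(\delta(h),x)$; (D4) $(x+d_0(x))\odot d_2(y,z)-d_2(x\odot y,z)+d_2(x,y\odot z)-d_2(x,y)\odot(z+d_0(z))=\mu(d_0(x),y,z)+\mu(x,d_0(y),z)+\mu(x,y,d_0(z))+\mu(d_0(x),d_0(y),z)+\mu(d_0(x),y,d_0(z))+\mu(x,d_0(y),d_0(z))+\mu(d_0(x),d_0(y),d_0(z))-d_1(\mu(x,y,z))$. The pair $(\mathfrak{a},\mathfrak{d})$ is a $2$-term difference $A_\infty$-algebra. **2-term bimodules up to homotopy of an associative algebra.** Let $A$ be an associative algebra. A $2$-term bimodule up to homotopy of $A$, denoted $(M_1\xrightarrow{\delta}M_0,\nu)$, consists of a linear map $\delta:M_1\to M_0$ of vector spaces; four bilinear maps $A\times M_0\to M_0$, $(a,v)\mapsto av$; $M_0\times A\to M_0$, $(v,a)\mapsto va$; $A\times M_1\to M_1$, $(a,\xi)\mapsto a\xi$; $M_1\times A\to M_1$, $(\xi,a)\mapsto\xi a$, satisfying $\delta(a\xi)=a\delta(\xi)$ and $\delta(\xi a)=\delta(\xi)a$;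 and three trilinear maps, all denoted $\nu$, $$\nu:A\times A\times M_0\to M_1,\quad\nu:A\times M_0\times A\to M_1,\quad\nu:M_0\times A\times A\to M_1,$$ such that for all $a,b,c\in A$, $v\in M_0$, $\xi\in M_1$: $a(bv)-(ab)v=\delta(\nu(a,b,v))$, $\ a(vb)-(av)b=\delta(\nu(a,v,b))$, $\ v(ab)-(va)b=\delta(\nu(v,a,b))$; $a(b\xi)-(ab)\xi=\nu(a,b,\delta(\xi))$, $\ a(\xi b)-(a\xi)b=\nu(a,\delta(\xi),b)$, $\ \xi(ab)-(\xi a)b=\nu(\delta(\xi),a,b)$; $a\,\nu(b,c,v)-\nu(ab,c,v)+\nu(a,bc,v)-\nu(a,b,cv)=0$; $a\,\nu(b,v,c)-\nu(ab,v,c)+\nu(a,bv,c)-\nu(a,b,vc)+\nu(a,b,v)\,c=0$; $a\,\nu(v,b,c)-\nu(av,b,c)+\nu(a,vb,c)-\nu(a,v,bc)+\nu(a,v,b)\,c=0$; $\nu(va,b,c)-\nu(v,ab,c)+\nu(v,a,bc)-\nu(v,a,b)\,c=0$. **2-term bimodules up to homotopy over a difference algebra.** A $2$-term bimodule up to homotopy over a difference algebra $(A,d)$ is a tuple $((M_1\xrightarrow{\delta}M_0,\nu),\Delta_0,\Delta_1,\theta)$, where $(M_1\xrightarrow{\delta}M_0,\nu)$ is a $2$-term bimodule up to homotopy of the associative algebra $A$; $\Delta_0:M_0\to M_0$ and $\Delta_1:M_1\to M_1$ are linear maps with $\Delta_0\circ\delta=\delta\circ\Delta_1$; and there are two bilinear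 maps, both denoted $\theta$, $\theta:A\times M_0\to M_1$ and $\theta:M_0\times A\to M_1$, such that for all $a,b\in A$, $v\in M_0$, $\xi\in M_1$: $d(a)v+a\Delta_0(v)+d(a)\Delta_0(v)-\Delta_0(av)=\delta(\theta(a,v))$; $\Delta_0(v)a+vd(a)+\Delta_0(v)d(a)-\Delta_0(va)=\delta(\theta(v,a))$; $d(a)\xi+a\Delta_1(\xi)+d(a)\Delta_1(\xi)-\Delta_1(a\xi)=\theta(a,\delta(\xi))$; $\Delta_1(\xi)a+\xi d(a)+\Delta_1(\xi)d(a)-\Delta_1(\xi a)=\theta(\delta(\xi),a)$; $(a+d(a))\theta(b,v)-\theta(ab,v)+\theta(a,bv)=\nu(d(a),b,v)+\nu(a,d(b),v)+\nu(a,b,\Delta_0(v))+\nu(d(a),d(b),v)+\nu(d(a),b,\Delta_0(v))+\nu(a,d(b),\Delta_0(v))+\nu(d(a),d(b),\Delta_0(v))-\Delta_1(\nu(a,b,v))$; $(a+d(a))\theta(v,b)-\theta(av,b)+\theta(a,vb)-\theta(a,v)(b+d(b))=\nu(d(a),v,b)+\nu(a,\Delta_0(v),b)+\nu(a,v,d(b))+\nu(d(a),\Delta_0(v),b)+\nu(d(a),v,d(b))+\nu(a,\Delta_0(v),d(b))+\nu(d(a),\Delta_0(v),d(b))-\Delta_1(\nu(a,v,b))$; $-\theta(va,b)+\theta(v,ab)-\theta(v,a)(b+d(b))=\nu(\Delta_0(v),a,b)+\nu(v,d(a),b)+\nu(v,a,d(b))+\nu(\Delta_0(v),d(a),b)+\nu(\Delta_0(v),a,d(b))+\nu(v,d(a),d(b))+\nu(\Delta_0(v),d(a),d(b))-\Delta_1(\nu(v,a,b))$.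 *)

(* Defs.v *)
From mathcomp Require Import all_boot all_order all_algebra.

Set Implicit Arguments.
Unset Strict Implicit.
Unset Printing Implicit Defensive.

Import GRing.Theory.
Local Open Scope ring_scope.

Section Multilinear.

Variables (k : fieldType).

(* Prop-valued counterpart of [bilinear_for *:%R *:%R f], which is a
   Type-valued pair. *)
Definition is_bilinear (U V W : lmodType k) (f : U -> V -> W) : Prop :=
  (forall v, linear (f^~ v)) /\ (forall u, linear (f u)).

Definition is_trilinear (U V W X : lmodType k) (f : U -> V -> W -> X) : Prop :=
  [/\ forall v w, linear (fun u => f u v w),
      forall u w, linear (fun v => f u v w)
    & forall u v, linear (fun w => f u v w)].

(* MathComp's algebra structures are unital, whereas the algebras here need
   not be: an algebra is a vector space with an explicit multiplication. *)
Record is_associative_algebra (A : lmodType k) (mul : A -> A -> A) : Prop := {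
  alg_mul_bilinear : is_bilinear mul;
  alg_mul_assoc : associative mul
}.

Record is_difference_algebra (A : lmodType k)
    (mul : A -> A -> A) (d : A -> A) : Prop := {
  diffalg_assoc : is_associative_algebra mul;
  diffalg_linear : linear d;
  diffalg_rule : forall a b,
    d (mul a b) = mul (d a) b + mul a (d b) + mul (d a) (d b)
}.

End Multilinear.

(* [odotij] is the component of the product on A_i x A_j. The component
   [odot11] should land in A_2 = 0; it is kept, with values in A_1, so that
   its vanishing is an explicit requirement (see [Ainf2_odot11_0]). *)
Record Ainf2_data (k : fieldType) (A1 A0 : lmodType k) := Ainf2Data {
  Ainf2_delta : A1 -> A0;
  Ainf2_odot00 : A0 -> A0 -> A0;
  Ainf2_odot01 : A0 -> A1 -> A1;
  Ainf2_odot10 : A1 -> A0 -> A1;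
  Ainf2_odot11 : A1 -> A1 -> A1;
  Ainf2_mu : A0 -> A0 -> A0 -> A1
}.

Record diffop2_data (k : fieldType) (A1 A0 : lmodType k) := Diffop2Data {
  diffop2_0 : A0 -> A0;
  diffop2_1 : A1 -> A1;
  diffop2_2 : A0 -> A0 -> A1
}.

Section Ainf2.

Variables (k : fieldType) (A1 A0 : lmodType k).
Variables (a : Ainf2_data A1 A0) (D : diffop2_data A1 A0).

Local Notation delta := (Ainf2_delta a).
Local Notation mu := (Ainf2_mu a).
Local Notation "x *00 y" := (Ainf2_odot00 a x y) (at level 40).
Local Notation "x *01 h" := (Ainf2_odot01 a x h) (at level 40).
Local Notation "h *10 x" := (Ainf2_odot10 a h x) (at level 40).
Local Notation "h *11 k" := (Ainf2_odot11 a h k) (at level 40).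

Record is_Ainf2 : Prop := {
  Ainf2_delta_linear : linear delta;
  Ainf2_odot00_bilinear : is_bilinear (Ainf2_odot00 a);
  Ainf2_odot01_bilinear : is_bilinear (Ainf2_odot01 a);
  Ainf2_odot10_bilinear : is_bilinear (Ainf2_odot10 a);
  Ainf2_odot11_0 : forall h k : A1, h *11 k = 0;
  Ainf2_mu_trilinear : is_trilinear mu;
  Ainf2_A1 : forall x h, delta (x *01 h) = x *00 delta h;
  Ainf2_A2 : forall x h, delta (h *10 x) = delta h *00 x;
  Ainf2_A3 : forall h k : A1, delta h *01 k = h *10 delta k;
  Ainf2_A4 : forall x y z,
    x *00 (y *00 z) - (x *00 y) *00 z = delta (mu x y z);
  Ainf2_A5 : forall x y h,
    x *01 (y *01 h) - (x *00 y) *01 h = mu x y (delta h);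
  Ainf2_A6 : forall x y h,
    x *01 (h *10 y) - (x *01 h) *10 y = mu x (delta h) y;
  Ainf2_A7 : forall x y h,
    h *10 (x *00 y) - (h *10 x) *10 y = mu (delta h) x y;
  Ainf2_A8 : forall x y z t,
    x *01 mu y z t - mu (x *00 y) z t + mu x (y *00 z) t
      - mu x y (z *00 t) + mu x y z *10 t = 0
}.

Local Notation d0 := (diffop2_0 D).
Local Notation d1 := (diffop2_1 D).
Local Notation d2 := (diffop2_2 D).

Record is_diffop2 : Prop := {
  diffop2_0_linear : linear d0;
  diffop2_1_linear : linear d1;
  diffop2_chain : forall h, d0 (delta h) = delta (d1 h);
  diffop2_2_bilinear : is_bilinear d2;
  diffop2_D1 : forall x y,
    d0 x *00 y + x *00 d0 y + d0 x *00 d0 y - d0 (x *00 y) = delta (d2 x y);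
  diffop2_D2 : forall x h,
    d0 x *01 h + x *01 d1 h + d0 x *01 d1 h - d1 (x *01 h) = d2 x (delta h);
  diffop2_D3 : forall x h,
    d1 h *10 x + h *10 d0 x + d1 h *10 d0 x - d1 (h *10 x) = d2 (delta h) x;
  diffop2_D4 : forall x y z,
    (x + d0 x) *01 d2 y z - d2 (x *00 y) z + d2 x (y *00 z)
      - d2 x y *10 (z + d0 z)
    = mu (d0 x) y z + mu x (d0 y) z + mu x y (d0 z)
      + mu (d0 x) (d0 y) z + mu (d0 x) y (d0 z) + mu x (d0 y) (d0 z)
      + mu (d0 x) (d0 y) (d0 z) - d1 (mu x y z)
}.

Definition is_difference_Ainf2 : Prop := is_Ainf2 /\ is_diffop2.

End Ainf2.

(* In the names below, A, 0 and 1 stand for arguments in A, M_0 and M_1: for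
   instance [bimod2_lact1 a xi] is a xi, [bimod2_ract1 xi a] is xi a, and
   [bimod2_nuA0A] is the component of nu on A x M_0 x A. *)
Record bimod2_data (k : fieldType) (A M1 M0 : lmodType k) := Bimod2Data {
  bimod2_delta : M1 -> M0;
  bimod2_lact0 : A -> M0 -> M0;
  bimod2_ract0 : M0 -> A -> M0;
  bimod2_lact1 : A -> M1 -> M1;
  bimod2_ract1 : M1 -> A -> M1;
  bimod2_nuAA0 : A -> A -> M0 -> M1;
  bimod2_nuA0A : A -> M0 -> A -> M1;
  bimod2_nu0AA : M0 -> A -> A -> M1
}.

Record diffbimod2_data (k : fieldType) (A M1 M0 : lmodType k) :=
  Diffbimod2Data {
  diffbimod2_Delta0 : M0 -> M0;
  diffbimod2_Delta1 : M1 -> M1;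
  diffbimod2_thetaA0 : A -> M0 -> M1;
  diffbimod2_theta0A : M0 -> A -> M1
}.

Section Bimod2.

Variables (k : fieldType) (A M1 M0 : lmodType k).
Variables (mul : A -> A -> A) (d : A -> A).
Variables (B : bimod2_data A M1 M0) (T : diffbimod2_data A M1 M0).

Local Notation "a *A b" := (mul a b) (at level 40).
Local Notation delta := (bimod2_delta B).
Local Notation "a *l0 v" := (bimod2_lact0 B a v) (at level 40).
Local Notation "v *r0 a" := (bimod2_ract0 B v a) (at level 40).
Local Notation "a *l1 xi" := (bimod2_lact1 B a xi) (at level 40).
Local Notation "xi *r1 a" := (bimod2_ract1 B xi a) (at level 40).
Local Notation nuAA0 := (bimod2_nuAA0 B).
Local Notation nuA0A := (bimod2_nuA0A B).
Local Notation nu0AA := (bimod2_nu0AA B).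

Record is_bimod2 : Prop := {
  bimod2_delta_linear : linear delta;
  bimod2_lact0_bilinear : is_bilinear (bimod2_lact0 B);
  bimod2_ract0_bilinear : is_bilinear (bimod2_ract0 B);
  bimod2_lact1_bilinear : is_bilinear (bimod2_lact1 B);
  bimod2_ract1_bilinear : is_bilinear (bimod2_ract1 B);
  bimod2_delta_lact : forall a xi, delta (a *l1 xi) = a *l0 delta xi;
  bimod2_delta_ract : forall a xi, delta (xi *r1 a) = delta xi *r0 a;
  bimod2_nuAA0_trilinear : is_trilinear nuAA0;
  bimod2_nuA0A_trilinear : is_trilinear nuA0A;
  bimod2_nu0AA_trilinear : is_trilinear nu0AA;
  bimod2_assocAA0 : forall a b v,
    a *l0 (b *l0 v) - (a *A b) *l0 v = delta (nuAA0 a b v);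
  bimod2_assocA0A : forall a b v,
    a *l0 (v *r0 b) - (a *l0 v) *r0 b = delta (nuA0A a v b);
  bimod2_assoc0AA : forall a b v,
    v *r0 (a *A b) - (v *r0 a) *r0 b = delta (nu0AA v a b);
  bimod2_assocAA1 : forall a b xi,
    a *l1 (b *l1 xi) - (a *A b) *l1 xi = nuAA0 a b (delta xi);
  bimod2_assocA1A : forall a b xi,
    a *l1 (xi *r1 b) - (a *l1 xi) *r1 b = nuA0A a (delta xi) b;
  bimod2_assoc1AA : forall a b xi,
    xi *r1 (a *A b) - (xi *r1 a) *r1 b = nu0AA (delta xi) a b;
  bimod2_pentagonAAA0 : forall a b c v,
    a *l1 nuAA0 b c v - nuAA0 (a *A b) c v + nuAA0 a (b *A c) v
      - nuAA0 a b (c *l0 v) = 0;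
  bimod2_pentagonAA0A : forall a b c v,
    a *l1 nuA0A b v c - nuA0A (a *A b) v c + nuA0A a (b *l0 v) c
      - nuAA0 a b (v *r0 c) + nuAA0 a b v *r1 c = 0;
  bimod2_pentagonA0AA : forall a b c v,
    a *l1 nu0AA v b c - nu0AA (a *l0 v) b c + nuA0A a (v *r0 b) c
      - nuA0A a v (b *A c) + nuA0A a v b *r1 c = 0;
  bimod2_pentagon0AAA : forall a b c v,
    nu0AA (v *r0 a) b c - nu0AA v (a *A b) c + nu0AA v a (b *A c)
      - nu0AA v a b *r1 c = 0
}.

Local Notation Delta0 := (diffbimod2_Delta0 T).
Local Notation Delta1 := (diffbimod2_Delta1 T).
Local Notation thetaA0 := (diffbimod2_thetaA0 T).
Local Notation theta0A := (diffbimod2_theta0A T).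

Record is_difference_bimod2 : Prop := {
  diffbimod2_bimod2 : is_bimod2;
  diffbimod2_Delta0_linear : linear Delta0;
  diffbimod2_Delta1_linear : linear Delta1;
  diffbimod2_chain : forall xi, Delta0 (delta xi) = delta (Delta1 xi);
  diffbimod2_thetaA0_bilinear : is_bilinear thetaA0;
  diffbimod2_theta0A_bilinear : is_bilinear theta0A;
  diffbimod2_ruleA0 : forall a v,
    d a *l0 v + a *l0 Delta0 v + d a *l0 Delta0 v - Delta0 (a *l0 v)
    = delta (thetaA0 a v);
  diffbimod2_rule0A : forall a v,
    Delta0 v *r0 a + v *r0 d a + Delta0 v *r0 d a - Delta0 (v *r0 a)
    = delta (theta0A v a);
  diffbimod2_ruleA1 : forall a xi,
    d a *l1 xi + a *l1 Delta1 xi + d a *l1 Delta1 xi - Delta1 (a *l1 xi)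
    = thetaA0 a (delta xi);
  diffbimod2_rule1A : forall a xi,
    Delta1 xi *r1 a + xi *r1 d a + Delta1 xi *r1 d a - Delta1 (xi *r1 a)
    = theta0A (delta xi) a;
  diffbimod2_ruleAA0 : forall a b v,
    (a + d a) *l1 thetaA0 b v - thetaA0 (a *A b) v + thetaA0 a (b *l0 v)
    = nuAA0 (d a) b v + nuAA0 a (d b) v + nuAA0 a b (Delta0 v)
      + nuAA0 (d a) (d b) v + nuAA0 (d a) b (Delta0 v)
      + nuAA0 a (d b) (Delta0 v)
      + nuAA0 (d a) (d b) (Delta0 v) - Delta1 (nuAA0 a b v);
  diffbimod2_ruleA0A : forall a b v,
    (a + d a) *l1 theta0A v b - theta0A (a *l0 v) b + thetaA0 a (v *r0 b)
      - thetaA0 a v *r1 (b + d b)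
    = nuA0A (d a) v b + nuA0A a (Delta0 v) b + nuA0A a v (d b)
      + nuA0A (d a) (Delta0 v) b + nuA0A (d a) v (d b)
      + nuA0A a (Delta0 v) (d b)
      + nuA0A (d a) (Delta0 v) (d b) - Delta1 (nuA0A a v b);
  diffbimod2_rule0AA : forall a b v,
    - theta0A (v *r0 a) b + theta0A v (a *A b) - theta0A v a *r1 (b + d b)
    = nu0AA (Delta0 v) a b + nu0AA v (d a) b + nu0AA v a (d b)
      + nu0AA (Delta0 v) (d a) b + nu0AA (Delta0 v) a (d b)
      + nu0AA v (d a) (d b)
      + nu0AA (Delta0 v) (d a) (d b) - Delta1 (nu0AA v a b)
}.

End Bimod2.

(* Main.v *)
Require Import Defs.
From mathcomp Require Import all_boot all_order all_algebra.

Import GRing.Theory.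
Local Open Scope ring_scope.

(** The construction is the semidirect product of [A] with the two-term
    bimodule, and the proof is a sort by degree in [M0]. Every structure map
    on the sum of [A] and [M0] is multilinear and keeps only the terms with
    at most one argument taken from [M0], so each axiom, once expanded over
    the two summands, splits into independent identities: one with all
    arguments in [A], and one for each position that an argument from [M0]
    can occupy. Nothing survives with two arguments from [M0].

    The identity with all arguments in [A] is that of the difference algebra
    itself: associativity in (A4), the difference rule in (D1), and nothing
    where the values lie in [M1], since [mu] and [d2] vanish on [A]. The
    others are exactly the bimodule axioms: three associators give (A4), four
    pentagons give (A8), two rules give (D1) and three rules give (D4). In
    the axioms (A5)-(A7), (D2) and (D3) the element of [M1] enters through
    [(0, delta xi)], which already occupies the single [M0] slot, so only one
    bimodule axiom remains. Both sides of (A3) vanish because [A] acts on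
    [M1] through the component in [A], which is zero for [(0, delta xi)].

    [semidirect_is_Ainf2] treats the underlying two-term algebra, for any
    associative algebra, and [semidirect_is_diffop2] the operator. *)

(** * Maps that satisfy the linearity predicate *)

Section LinearMaps.

Context {k : fieldType}.
Implicit Types U V W X : lmodType k.

Lemma linear_morphD {U V} {f : U -> V} : linear f -> {morph f : x y / x + y}.
Proof. by move=> lf x y; have := lf 1 x y; rewrite !scale1r. Qed.

Lemma linear_at0 {U V} {f : U -> V} : linear f -> f 0 = 0.
Proof.
by move=> lf; have := lf (-1) 0 0; rewrite scaler0 addr0 scaleN1r addNr.
Qed.

Lemma linear_sum2 {U V} {f g : U -> V} :
  linear f -> linear g -> linear (fun x => f x + g x).
Proof. by move=> lf lg c x y; rewrite lf lg scalerDr addrACA. Qed.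

Lemma linear_pair {U V W} {f : U -> V} {g : U -> W} :
  linear f -> linear g -> linear (fun x => (f x, g x) : (V * W)%type).
Proof. by move=> lf lg c x y; rewrite lf lg. Qed.

Lemma linear_on_fst {U V W} {f : U -> W} :
  linear f -> linear (fun x : (U * V)%type => f x.1).
Proof. by move=> lf c x y; rewrite /= lf. Qed.

Lemma linear_on_snd {U V W} {f : V -> W} :
  linear f -> linear (fun x : (U * V)%type => f x.2).
Proof. by move=> lf c x y; rewrite /= lf. Qed.

Lemma linear_zero_map {U V} : linear (fun _ : U => 0 : V).
Proof. by move=> c x y; rewrite scaler0 addr0. Qed.

Section Bilinear.

Context {U V W : lmodType k} {f : U -> V -> W} (bf : is_bilinear f).

Lemma bilinearDl x y v : f (x + y) v = f x v + f y v.
Proof. exact: (linear_morphD (bf.1 v)). Qed.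

Lemma bilinearDr u x y : f u (x + y) = f u x + f u y.
Proof. exact: (linear_morphD (bf.2 u)). Qed.

Lemma bilinear0l v : f 0 v = 0.
Proof. exact: (linear_at0 (bf.1 v)). Qed.

Lemma bilinear0r u : f u 0 = 0.
Proof. exact: (linear_at0 (bf.2 u)). Qed.

End Bilinear.

Section Trilinear.

Context {U V W X : lmodType k} {f : U -> V -> W -> X} (tf : is_trilinear f).

Lemma trilinearD1 x y v w : f (x + y) v w = f x v w + f y v w.
Proof. by case: tf => lf _ _; exact: (linear_morphD (lf v w)). Qed.

Lemma trilinearD2 u x y w : f u (x + y) w = f u x w + f u y w.
Proof. by case: tf => _ lf _; exact: (linear_morphD (lf u w)). Qed.

Lemma trilinearD3 u v x y : f u v (x + y) = f u v x + f u v y.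
Proof. by case: tf => _ _ lf; exact: (linear_morphD (lf u v)). Qed.

Lemma trilinear01 v w : f 0 v w = 0.
Proof. by case: tf => lf _ _; exact: (linear_at0 (lf v w)). Qed.

Lemma trilinear02 u w : f u 0 w = 0.
Proof. by case: tf => _ lf _; exact: (linear_at0 (lf u w)). Qed.

Lemma trilinear03 u v : f u v 0 = 0.
Proof. by case: tf => _ _ lf; exact: (linear_at0 (lf u v)). Qed.

End Trilinear.

(** This serves both the product on the sum of [A] and [M0] and [d2]: the two
    summands are the two ways of taking one argument from [V]. *)
Lemma semidirect_bilinear {U V W} {f : U -> V -> W} {g : V -> U -> W} :
  is_bilinear f -> is_bilinear g ->
  is_bilinear (fun x y : (U * V)%type => f x.1 y.2 + g x.2 y.1).
Proof.
move=> [fl fr] [gl gr]; split=> [y|x].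
  exact: linear_sum2 (linear_on_fst (fl y.2)) (linear_on_snd (gl y.1)).
exact: linear_sum2 (linear_on_snd (fr x.1)) (linear_on_fst (gr x.2)).
Qed.

Lemma semidirect_trilinear {U V W} {f : U -> U -> V -> W}
    {g : U -> V -> U -> W} {h : V -> U -> U -> W} :
  is_trilinear f -> is_trilinear g -> is_trilinear h ->
  is_trilinear (fun x y z : (U * V)%type =>
    f x.1 y.1 z.2 + g x.1 y.2 z.1 + h x.2 y.1 z.1).
Proof.
move=> [f1 f2 f3] [g1 g2 g3] [h1 h2 h3]; split=> [y z|x z|x y].
- exact: linear_sum2 (linear_sum2 (linear_on_fst (f1 y.1 z.2))
    (linear_on_fst (g1 y.2 z.1))) (linear_on_snd (h1 y.1 z.1)).
- exact: linear_sum2 (linear_sum2 (linear_on_fst (f2 x.1 z.2))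
    (linear_on_snd (g2 x.1 z.1))) (linear_on_fst (h2 x.2 z.1)).
- exact: linear_sum2 (linear_sum2 (linear_on_snd (f3 x.1 y.1))
    (linear_on_fst (g3 x.1 y.2))) (linear_on_fst (h3 x.2 y.1)).
Qed.

End LinearMaps.

(** * The two-term algebra *)

Section SemidirectAinf2.

Context {k : fieldType} {A M1 M0 : lmodType k}.
Variables (mul : A -> A -> A) (B : bimod2_data A M1 M0).

Definition semidirect_Ainf2 : Ainf2_data M1 (A * M0)%type :=
  {| Ainf2_delta := fun xi => (0, bimod2_delta B xi);
     Ainf2_odot00 := fun x y =>
       (mul x.1 y.1, bimod2_lact0 B x.1 y.2 + bimod2_ract0 B x.2 y.1);
     Ainf2_odot01 := fun x xi => bimod2_lact1 B x.1 xi;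
     Ainf2_odot10 := fun xi x => bimod2_ract1 B xi x.1;
     Ainf2_odot11 := fun xi eta => 0;
     Ainf2_mu := fun x y z =>
       bimod2_nuAA0 B x.1 y.1 z.2 + bimod2_nuA0A B x.1 y.2 z.1
       + bimod2_nu0AA B x.2 y.1 z.1 |}.

Lemma semidirect_is_Ainf2 :
  is_associative_algebra mul -> is_bimod2 mul B -> is_Ainf2 semidirect_Ainf2.
Proof.
move=> [bm mulA] [ldelta bl0 br0 bl1 br1 deltal deltar tAA0 tA0A t0AA
  assAA0 assA0A ass0AA assAA1 assA1A ass1AA pAAA0 pAA0A pA0AA p0AAA].
have bprod := semidirect_bilinear bl0 br0.
split=> //=.
- exact: linear_pair linear_zero_map ldelta.
- split=> [y|x].
    exact: linear_pair (linear_on_fst (bm.1 y.1)) (bprod.1 y).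
  exact: linear_pair (linear_on_fst (bm.2 x.1)) (bprod.2 x).
- by split=> [xi|x]; [exact: linear_on_fst (bl1.1 xi) | exact: bl1.2].
- by split=> [x|xi]; [exact: br1.1 | exact: linear_on_fst (br1.2 xi)].
- exact: semidirect_trilinear.
- by move=> x h; rewrite deltal (bilinear0r bm) (bilinear0r br0) addr0.
- by move=> x h; rewrite deltar (bilinear0l bm) (bilinear0l bl0) add0r.
- by move=> h h'; rewrite (bilinear0l bl1) (bilinear0r br1).
- move=> [a u] [b v] [c w]; apply: injective_projections => /=.
    by rewrite mulA subrr.
  rewrite !(linear_morphD ldelta) -assAA0 -assA0A -ass0AA.
  rewrite (bilinearDr bl0) (bilinearDl br0) !opprD !addrA.
  by rewrite [LHS](ACl (1*4*2*5*3*6)).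
- move=> x y h.
  by rewrite assAA1 (trilinear03 tA0A) (trilinear03 t0AA) !addr0.
- move=> x y h.
  by rewrite assA1A (trilinear02 tAA0) (trilinear02 t0AA) add0r addr0.
- move=> x y h.
  by rewrite ass1AA (trilinear01 tAA0) (trilinear01 tA0A) !add0r.
- move=> [a u] [b v] [c w] [e s] /=.
  rewrite !(bilinearDr bl1) !(bilinearDl br1).
  rewrite (trilinearD1 t0AA) (trilinearD2 tA0A) (trilinearD3 tAA0).
  rewrite !opprD !addrA.
  (* The groups collect the terms with [s], [w], [v] and [u]; the last one is
     the opposite of the pentagon on [M0 * A * A * A]. *)
  rewrite [LHS](ACl ((1*4*8*12)*(2*5*9*13*16)*(3*6*10*14*17)*(7*11*15*18))).
  rewrite /= pAAA0 pAA0A pA0AA !add0r.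
  by apply/eqP; rewrite -oppr_eq0 !opprD !opprK p0AAA.
Qed.

End SemidirectAinf2.

(** * The difference operator *)

Section SemidirectDiffop2.

Context {k : fieldType} {A M1 M0 : lmodType k}.
Variables (mul : A -> A -> A) (d : A -> A).
Variables (B : bimod2_data A M1 M0) (T : diffbimod2_data A M1 M0).

Definition semidirect_diffop2 : diffop2_data M1 (A * M0)%type :=
  {| diffop2_0 := fun x => (d x.1, diffbimod2_Delta0 T x.2);
     diffop2_1 := diffbimod2_Delta1 T;
     diffop2_2 := fun x y =>
       diffbimod2_thetaA0 T x.1 y.2 + diffbimod2_theta0A T x.2 y.1 |}.

Lemma semidirect_is_diffop2 :
  is_difference_algebra mul d -> is_difference_bimod2 mul d B T ->
  is_diffop2 (semidirect_Ainf2 mul B) semidirect_diffop2.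
Proof.
move=> [_ ld dM] [[ldelta bl0 br0 bl1 br1 _ _ _ _ _ _ _ _ _ _ _ _ _ _ _]
  lDelta0 lDelta1 chain bA0 b0A ruleA0 rule0A ruleA1 rule1A
  ruleAA0 ruleA0A rule0AA].
split=> //=.
- exact: linear_pair (linear_on_fst ld) (linear_on_snd lDelta0).
- by move=> h; rewrite (linear_at0 ld) chain.
- exact: semidirect_bilinear.
- move=> [a u] [b v]; apply: injective_projections => /=.
    by rewrite dM subrr.
  rewrite !(linear_morphD ldelta, linear_morphD lDelta0) -ruleA0 -rule0A.
  by rewrite opprD !addrA [LHS](ACl ((1*3*5*7)*(2*4*6*8))) /= !addrA.
- by move=> x h; rewrite ruleA1 (bilinear0r b0A) addr0.
- by move=> x h; rewrite rule1A (bilinear0l bA0) add0r.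
- move=> [a u] [b v] [c w] /=.
  rewrite !(linear_morphD lDelta1) !opprD !addrA.
  (* Each term on the right of (D4) contributes three consecutive
     summands, one for each position of the argument from [M0]; the groups
     are the positions. *)
  rewrite [RHS](ACl ((1*4*7*10*13*16*19*22)*(2*5*8*11*14*17*20*23)
                     *(3*6*9*12*15*18*21*24))) /=.
  rewrite -ruleAA0 -ruleA0A -rule0AA.
  rewrite (bilinearDr bl1) (bilinearDr bA0) (bilinearDl b0A).
  rewrite (bilinearDl br1) !opprD !addrA.
  by rewrite [LHS](ACl (1*3*6*2*4*7*9*5*8*10)).
Qed.

End SemidirectDiffop2.

Theorem proposition5p8 (k : fieldType) (char0 : [pchar k] =i pred0)
    (A : lmodType k) (mul : A -> A -> A) (d : A -> A)
    (Ad : is_difference_algebra mul d)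
    (M1 M0 : lmodType k)
    (B : bimod2_data A M1 M0) (T : diffbimod2_data A M1 M0)
    (BT : is_difference_bimod2 mul d B T) :
  @is_difference_Ainf2 k M1 (A * M0)%type
    {| Ainf2_delta := fun xi => (0, bimod2_delta B xi);
       Ainf2_odot00 := fun x y =>
         (mul x.1 y.1, bimod2_lact0 B x.1 y.2 + bimod2_ract0 B x.2 y.1);
       Ainf2_odot01 := fun x xi => bimod2_lact1 B x.1 xi;
       Ainf2_odot10 := fun xi x => bimod2_ract1 B xi x.1;
       Ainf2_odot11 := fun xi eta => 0;
       Ainf2_mu := fun x y z =>
         bimod2_nuAA0 B x.1 y.1 z.2 + bimod2_nuA0A B x.1 y.2 z.1
         + bimod2_nu0AA B x.2 y.1 z.1 |}
    {| diffop2_0 := fun x => (d x.1, diffbimod2_Delta0 T x.2);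
       diffop2_1 := diffbimod2_Delta1 T;
       diffop2_2 := fun x y =>
         diffbimod2_thetaA0 T x.1 y.2 + diffbimod2_theta0A T x.2 y.1 |}.
Proof.
split; last exact: semidirect_is_diffop2.
exact: semidirect_is_Ainf2 (diffalg_assoc Ad) (diffbimod2_bimod2 BT).
Qed.
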